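(* Let $f\in\mathcal{F}_2$, i.e. $f\in\mathcal{S}$ and $\operatorname{Re}\{(1-z^2)f'(z)\}>0$ for all $z\in\mathbb{D}$. Then the third logarithmic coefficient $\gamma_3$ of $f$ satisfies $$|\gamma_3|\leq 0.258765\cdots.$$
   Context: $\mathbb{D}=\{z\in\mathbb{C}:|z|<1\}$ is the open unit disk. $\mathcal{A}$ is the set of all analytic functions $f$ in $\mathbb{D}$ of the form $f(z)=\sum_{n=1}^{\infty}a_nz^n$ with $a_1=1$ (that is, $f(0)=0$, $f'(0)=1$), and $\mathcal{S}\subset\mathcal{A}$ is the subclass of functions univalent (injective) in $\mathbb{D}$. $\mathcal{F}_2$ is the class of $f\in\mathcal{S}$ with $\operatorname{Re}\{(1-z^2)f'(z)\}>0$ for all $z\in\mathbb{D}$. For $f\in\mathcal{S}$, the logarithmic coefficients $\gamma_n$ ($n\ge 1$) of $f$ are the complex numbers defined by $\log\frac{f(z)}{z}=2\sum_{n=1}^{\infty}\gamma_nz^n$, $z\in\mathbb{D}\setminus\{0\}$, with $\log 1:=0$. The coefficients $a_n$ may be complex; in particular $f''(0)=2a_2$ is not assumed real. The bound is a numerical constant given by its leading decimal digits, the dots standing for further digits. *)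

(* Defs.v *)
From Stdlib Require Import Reals Lra.
From Coquelicot Require Import Coquelicot.

Open Scope R_scope.

(* Functions on the disk are total maps [C -> C]; every definition below uses
   their values on the open unit disk only. *)
Definition in_disk (z : C) : Prop := Cmod z < 1.

Definition Cexp (z : C) : C :=
  (exp (Re z) * cos (Im z), exp (Re z) * sin (Im z)).

(* [l = sum_{n >= 1} b_n z^n]; the value [b 0] is not used. *)
Definition is_pseries1 (b : nat -> C) (z l : C) : Prop :=
  is_series (K := C_AbsRing) (V := C_NormedModule)
    (fun n => Cmult (b (S n)) (Cpow z (S n))) l.

Definition class_A (f : C -> C) : Prop :=
  exists a : nat -> C,
    a 1%nat = RtoC 1 /\
    forall z, in_disk z -> is_pseries1 a z (f z).

Definition univalent (f : C -> C) : Prop :=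
  forall z w, in_disk z -> in_disk w -> f z = f w -> z = w.

Definition class_S (f : C -> C) : Prop := class_A f /\ univalent f.

Definition class_F2 (f : C -> C) : Prop :=
  class_S f /\
  forall z, in_disk z -> 0 < Re ((1 - z ^ 2) * C_derive f z)%C.

(* [L] is the branch of [log (f z / z)] on the disk with value [log 1 = 0] at
   the origin, where [f z / z] extends by [f'(0) = 1]. *)
Definition is_log_branch (f L : C -> C) : Prop :=
  (forall z, in_disk z ->
     ex_derive (K := C_AbsRing) (V := C_NormedModule) L z) /\
  L (RtoC 0) = RtoC 0 /\
  forall z, in_disk z -> z <> RtoC 0 -> Cexp (L z) = (f z / z)%C.

Definition is_log_coeffs (f : C -> C) (gamma : nat -> C) : Prop :=
  exists L : C -> C,
    is_log_branch f L /\
    forall z, in_disk z -> z <> RtoC 0 ->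
      is_pseries1 (fun n => RtoC 2 * gamma n)%C z (L z).

(* The constant 0.258765... in closed form. For [f] in [class_F2], the function
   [p = (1 - z^2) f' = 1 + c_1 z + c_2 z^2 + ...] has positive real part and
     48 gamma_3 = 2 c_1 + 6 c_3 - 4 c_1 c_2 + c_1^3.
   Expressing c_2, c_3 by c = |c_1| in [0, 2] and parameters in the closed disk
   and applying the triangle inequality leaves at most
     12 + 2 c - (8/3) c^2 + (2/3) c^3,
   which is maximal at c = (4 - sqrt 7) / 3. *)
Definition gamma3_bound : R := (233 + 7 * sqrt 7) / 972.

Lemma gamma3_bound_digits : 0.258765 <= gamma3_bound < 0.258766.
Proof.
assert (H : 2.64575 < sqrt 7 < 2.64576).
{ split.
  - apply Rsqr_incrst_0; [rewrite Rsqr_sqrt; unfold Rsqr; lra | lra | apply sqrt_pos].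
  - apply Rsqr_incrst_0; [rewrite Rsqr_sqrt; unfold Rsqr; lra | apply sqrt_pos | lra]. }
unfold gamma3_bound; lra.
Qed.

(* Main.v *)
(* The coefficients c_n of p = (1 - z^2) f' determine a_2, a_3, a_4, hence gamma_3:
   48 gamma_3 = 2 c_1 + (6 c_3 - 4 c_1 c_2 + c_1^3).  The bracket has a modulus
   invariant under rotations of p, so there c_1 may be taken real.  Averaging Re p |q|^2
   over the circle, for q of degree at most 3, shows that a Toeplitz form in c_1, c_2, c_3
   is nonnegative; evaluating it at vectors orthogonalised against the middle basis
   vectors confines c_2, and then c_3, to disks with explicit centres and radii.
   Replacing p by p (r z), r < 1, makes |c_1| < 2, so that nothing degenerates, and
   gives convergence on the closed disk.  The relation between the a_n and the gamma_n is read off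
   by comparing expansions of f z / z and exp (L z) up to order 4 along the positive reals. *)
Require Import Defs.
From Stdlib Require Import Reals Lra Lia.
From Coquelicot Require Import Coquelicot.

Local Notation is_seriesC := (is_series (K := C_AbsRing) (V := C_NormedModule)).
Local Notation csum := (sum_n (G := C_AbelianMonoid)).

(** * Complex series *)

Lemma Cmod_sum_n_le (u : nat -> C) (n : nat) :
  Cmod (sum_n (G := C_AbelianMonoid) u n) <= sum_n (fun k => Cmod (u k)) n.
Proof.
  induction n as [|n IH].
  - rewrite !sum_O; lra.
  - rewrite !sum_Sn. eapply Rle_trans; [apply Cmod_triangle|].
    change (plus ?a ?b) with (a + b) at 1. lra.
Qed.

Lemma is_seriesC_mod_le (u : nat -> C) (v : nat -> R) (l : C) :
  is_seriesC u l -> (forall n, Cmod (u n) <= v n) -> ex_series v ->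
  Cmod l <= Series v.
Proof.
  intros Hu Huv Hv.
  assert (H1 : is_lim_seq (fun n => Cmod (sum_n (G := C_AbelianMonoid) u n)) (Cmod l)).
  { change (Cmod l) with (@norm C_AbsRing C_NormedModule l).
    apply (filterlim_comp _ _ _ (sum_n (G := C_AbelianMonoid) u)
             (@norm C_AbsRing C_NormedModule) _ (locally l) _).
    - exact Hu.
    - apply (filterlim_norm (K := C_AbsRing) (V := C_NormedModule)). }
  apply Series_correct in Hv.
  refine (is_lim_seq_le _ _ (Finite _) (Finite _) _ H1 Hv).
  intros n. eapply Rle_trans; [apply Cmod_sum_n_le|].
  apply sum_n_m_le; auto.
Qed.

Lemma is_series_ReIm (u : nat -> C) (x y : R) :
  is_series (fun n => Re (u n)) x -> is_series (fun n => Im (u n)) y ->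
  is_seriesC u (x, y).
Proof.
  intros Hx Hy. unfold is_series in *.
  assert (E : forall n, sum_n (G := C_AbelianMonoid) u n
     = (sum_n (fun n => Re (u n)) n, sum_n (fun n => Im (u n)) n)).
  { induction n as [|n IH]; [rewrite !sum_O; now destruct (u 0%nat)|].
    rewrite !sum_Sn, IH. reflexivity. }
  intros P [e He].
  destruct (proj1 (filterlim_locally _ _) Hx e) as [N1 H1].
  destruct (proj1 (filterlim_locally _ _) Hy e) as [N2 H2].
  exists (N1 + N2)%nat. intros n Hn. apply He.
  change (ball (M := C_UniformSpace) (x, y) e (sum_n (G := C_AbelianMonoid) u n)).
  rewrite E. split; [apply H1 | apply H2]; lia.
Qed.

Lemma ex_series_Cmod (u : nat -> C) :
  ex_series (fun n => Cmod (u n)) -> exists l, is_seriesC u l.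
Proof.
  intros H.
  assert (Hx : ex_series (fun n => Re (u n))).
  { apply ex_series_Rabs. apply (ex_series_le (K := R_AbsRing) (V := R_CompleteNormedModule) _ (fun n => Cmod (u n))); auto.
    intros n. change (Rabs (Rabs (Re (u n))) <= Cmod (u n)).
    rewrite Rabs_Rabsolu. apply re_le_Cmod. }
  assert (Hy : ex_series (fun n => Im (u n))).
  { apply ex_series_Rabs. apply (ex_series_le (K := R_AbsRing) (V := R_CompleteNormedModule) _ (fun n => Cmod (u n))); auto.
    intros n. change (Rabs (Rabs (Im (u n))) <= Cmod (u n)).
    rewrite Rabs_Rabsolu. eapply Rle_trans; [apply Rmax_r|apply Rmax_Cmod]. }
  destruct Hx as [x Hx], Hy as [y Hy]. exists (x, y). now apply is_series_ReIm.
Qed.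

Lemma is_seriesC_eventually_le (u : nat -> C) (l : C) :
  is_seriesC u l -> exists N, forall n, (N <= n)%nat -> Cmod (u n) <= 1.
Proof.
  intros H.
  destruct (proj1 (filterlim_locally_ball_norm (K := C_AbsRing) (U := C_NormedModule)
    _ l) H (mkposreal (1/2) ltac:(lra))) as [N HN].
  (* The term [u n] is the difference of the partial sums at [n - 1] and [n], both within 1/2 of
     [l]; the index [n - 1] is why [S N] is taken. *)
  exists (S N). intros n Hn. destruct n as [|n]; [lia|].
  pose proof (HN n ltac:(lia)) as A. pose proof (HN (S n) ltac:(lia)) as B.
  unfold ball_norm in A, B. simpl in A, B.
  rewrite sum_Sn in B.
  set (s := sum_n _ n) in *.
  replace (u (S n)) with (Cminus (minus (plus s (u (S n))) l) (minus s l)).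
  - eapply Rle_trans; [apply Cmod_triangle|]. rewrite Cmod_opp.
    change (Cmod (minus s l) < 1/2) in A.
    change (Cmod (minus (plus s (u (S n))) l) < 1/2) in B. lra.
  - change (((s + u (S n)) - l) - (s - l) = u (S n))%C. ring.
Qed.

(** Abel's argument: convergence at the larger radius [s = (1 + r) / 2] makes [|b_n| s^n <= 1] from
    some index on, so [|b_n| r^n] is dominated by the geometric series of ratio [r / s < 1]. *)
Lemma ex_series_Cmod_disk (b : nat -> C) :
  (forall z, in_disk z -> exists l, is_seriesC (fun n => b n * z ^ n)%C l) ->
  forall r, 0 <= r < 1 -> ex_series (fun n => Cmod (b n) * r ^ n).
Proof.
  intros H r Hr. set (s := (1 + r) / 2).
  assert (Hs : 0 < s < 1) by (unfold s; lra).
  destruct (H (RtoC s)) as [l Hl].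
  { unfold in_disk. rewrite Cmod_R, Rabs_pos_eq; lra. }
  destruct (is_seriesC_eventually_le _ _ Hl) as [N HN].
  apply (ex_series_incr_n _ N).
  assert (Hq : Rabs (r / s) < 1).
  { rewrite Rabs_pos_eq. apply Rmult_lt_reg_r with s; [lra|]. field_simplify; unfold s; lra.
    apply Rdiv_le_0_compat; lra. }
  apply (ex_series_le (K := R_AbsRing) (V := R_CompleteNormedModule) _ (fun k => (r / s) ^ (N + k))).
  - intros k. change (Rabs (Cmod (b (N + k)%nat) * r ^ (N + k)) <= (r / s) ^ (N + k)).
    specialize (HN (N + k)%nat ltac:(lia)). set (m := (N + k)%nat) in *.
    rewrite Cmod_mult, Cmod_pow, Cmod_R, (Rabs_pos_eq s) in HN by lra.
    pose proof (Cmod_ge_0 (b m)). pose proof (pow_le r m (proj1 Hr)).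
    rewrite Rabs_pos_eq by (apply Rmult_le_pos; auto).
    assert (0 < s ^ m) by (apply pow_lt; lra).
    unfold Rdiv. rewrite Rpow_mult_distr, pow_inv.
    apply Rmult_le_reg_r with (s ^ m); auto. field_simplify; [|lra].
    replace (Cmod (b m) * r ^ m * s ^ m) with (r ^ m * (Cmod (b m) * s ^ m)) by ring.
    rewrite <- (Rmult_1_r (r ^ m)) at 2. now apply Rmult_le_compat_l.
  - apply (ex_series_incr_n (fun k => (r / s) ^ k) N). now apply ex_series_geom.
Qed.

(** * Power series in the disk *)

Lemma is_seriesC_ext (u v : nat -> C) (l : C) :
  (forall n, u n = v n) -> is_seriesC u l -> is_seriesC v l.
Proof. apply is_series_ext. Qed.

Lemma is_seriesC_mult (c : C) (u : nat -> C) (l : C) :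
  is_seriesC u l -> is_seriesC (fun n => c * u n)%C (c * l)%C.
Proof. intros H. exact (is_series_scal (K := C_AbsRing) (V := C_NormedModule) c u l H). Qed.

Lemma is_seriesC_minus (u v : nat -> C) (l m : C) :
  is_seriesC u l -> is_seriesC v m -> is_seriesC (fun n => u n - v n)%C (l - m)%C.
Proof. intros H1 H2. exact (is_series_minus (K := C_AbsRing) (V := C_NormedModule) u v l m H1 H2). Qed.

Lemma is_seriesC_tail (u : nat -> C) (l : C) :
  is_seriesC u l -> is_seriesC (fun n => u (S n)) (l - u 0%nat)%C.
Proof.
  intros H. apply (is_series_incr_1 (K := C_AbsRing) (V := C_NormedModule)).
  change (is_seriesC u (l - u 0%nat + u 0%nat)%C).
  now replace (l - u 0%nat + u 0%nat)%C with l by ring.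
Qed.

Lemma is_seriesC_cons (u : nat -> C) (l : C) :
  is_seriesC (fun n => u (S n)) l -> is_seriesC u (u 0%nat + l)%C.
Proof.
  intros H. apply (is_series_decr_1 (K := C_AbsRing) (V := C_NormedModule)).
  change (is_seriesC (fun n => u (S n)) ((u 0%nat + l) - u 0%nat)%C).
  now replace ((u 0%nat + l) - u 0%nat)%C with l by ring.
Qed.

(* The remainders [e_n = w^n - z^n - n z^(n-1) (w - z)] satisfy
   [e_(n+1) = w e_n + n z^(n-1) (w - z)^2]. *)
Lemma Cpow_taylor2 (z w : C) (r : R) (n : nat) :
  Cmod z <= r -> Cmod w <= r ->
  Cmod (w ^ S (S n) - z ^ S (S n) - RtoC (INR (S (S n))) * z ^ S n * (w - z))
    <= INR (S n) * INR (S (S n)) * r ^ n * Cmod (w - z) ^ 2.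
Proof.
  intros Hz Hw.
  pose proof (Cmod_ge_0 z) as Hz0. pose proof (Cmod_ge_0 w) as Hw0.
  assert (Hr : 0 <= r) by lra.
  pose proof (pow2_ge_0 (Cmod (w - z))) as Hq.
  induction n as [|n IH].
  - replace (w ^ 2 - z ^ 2 - RtoC (INR 2) * z ^ 1 * (w - z))%C with ((w - z) ^ 2)%C
      by (simpl INR; rewrite RtoC_plus; ring).
    rewrite Cmod_pow. simpl INR. simpl (r ^ 0). nra.
  - replace (w ^ S (S (S n)) - z ^ S (S (S n)) - RtoC (INR (S (S (S n)))) * z ^ S (S n) * (w - z))%C
      with (w * (w ^ S (S n) - z ^ S (S n) - RtoC (INR (S (S n))) * z ^ S n * (w - z))
            + RtoC (INR (S (S n))) * z ^ S n * (w - z) ^ 2)%C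
      by (rewrite (S_INR (S (S n))), RtoC_plus; simpl; ring).
    eapply Rle_trans; [apply Cmod_triangle|].
    rewrite !Cmod_mult, !Cmod_pow, Cmod_R.
    pose proof (pos_INR n) as Hn.
    rewrite Rabs_pos_eq by apply pos_INR.
    set (e := Cmod (_ - _ - _)) in *. set (q := Cmod (w - z) ^ 2) in *.
    assert (A : Cmod w * e <= r * (INR (S n) * INR (S (S n)) * r ^ n * q)).
    { apply Rmult_le_compat; auto. apply Cmod_ge_0. }
    assert (B : Cmod z ^ S n <= r ^ S n) by (apply pow_incr; lra).
    rewrite !S_INR in *.
    assert (D : (INR n + 1 + 1) * Cmod z ^ S n * q <= (INR n + 1 + 1) * r ^ S n * q).
    { apply Rmult_le_compat_r; auto. apply Rmult_le_compat_l; lra. }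
    assert (P : 0 <= r ^ S n * q * (INR n + 1 + 1)).
    { apply Rmult_le_pos; [apply Rmult_le_pos; auto; apply pow_le; auto | lra]. }
    simpl (r ^ S n) in *. nra.
Qed.

(** Convergence at every [s < 1] pushes the radius of convergence beyond [r], and [PS_derive]
    preserves that radius; the two series are the first and second formal derivatives. Since the
    terms are nonnegative, each one is bounded by the full sum. *)
Lemma ex_series_second_derivative (b : nat -> R) (r : R) :
  (forall s, 0 <= s < 1 -> ex_series (fun n => b n * s ^ n)) ->
  (forall n, 0 <= b n) -> 0 <= r < 1 ->
  ex_series (fun n => INR (S n) * b (S n) * r ^ n) /\
  ex_series (fun n => INR (S n) * INR (S (S n)) * b (S (S n)) * r ^ n).
Proof.
  intros H Hb Hr.
  assert (HR : Rbar_lt (Finite (Rabs r)) (CV_radius b)).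
  { rewrite Rabs_pos_eq by lra.
    apply Rbar_lt_le_trans with (Finite ((1 + r) / 2)); [simpl; lra|].
    apply (CV_radius_bounded b). set (s := (1 + r) / 2).
    assert (Hs : 0 <= s < 1) by (unfold s; lra).
    exists (Series (fun n => b n * s ^ n)). intros n.
    assert (P : forall k, 0 <= b k * s ^ k).
    { intros k. apply Rmult_le_pos; auto. apply pow_le; lra. }
    rewrite Rabs_pos_eq by auto.
    specialize (H s Hs). apply Series_correct in H.
    apply Rle_trans with (sum_n (fun k => b k * s ^ k) n).
    - destruct n; [rewrite sum_O; lra|]. rewrite sum_Sn.
      assert (Q : 0 <= sum_n (fun k => b k * s ^ k) n).
      { clear -P. induction n; [rewrite sum_O; auto|]. rewrite sum_Sn.
        change (plus ?a ?b) with (a + b). specialize (P (S n)). lra. }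
      change (plus ?a ?b) with (a + b). lra.
    - apply (is_lim_seq_incr_compare (sum_n (fun k => b k * s ^ k)) _ H).
      intros k. rewrite sum_Sn. change (plus ?a ?b) with (a + b).
      specialize (P (S k)). lra. }
  assert (HR' : Rbar_lt (Finite (Rabs r)) (CV_radius (PS_derive b)))
    by now rewrite CV_radius_derive.
  split.
  - apply ex_pseries_derive in HR. destruct HR as [l Hl]. exists l.
    apply is_pseries_R in Hl. exact Hl.
  - apply ex_pseries_derive in HR'. destruct HR' as [l Hl]. exists l.
    apply is_pseries_R in Hl. eapply is_series_ext; [|exact Hl].
    intros n. unfold PS_derive. simpl. ring.
Qed.

(** Termwise differentiation. The formal derivative converges to some [G], and summing
    [Cpow_taylor2] gives [|F w - F z - G (w - z)| <= M |w - z|^2] on the disk of radius [r], with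
    [r] midway between [|z|] and 1; this identifies [G] as the derivative. *)
Lemma C_derive_power_series (b : nat -> C) (F : C -> C) (z : C) :
  (forall w, in_disk w -> is_seriesC (fun n => b n * w ^ n)%C (F w)) ->
  in_disk z ->
  is_seriesC (fun n => RtoC (INR (S n)) * b (S n) * z ^ n)%C (C_derive F z).
Proof.
  intros HF Hz.
  pose proof (Cmod_ge_0 z) as Hz0. unfold in_disk in Hz.
  set (r := (1 + Cmod z) / 2). assert (Hr : 0 <= r < 1) by (unfold r; lra).
  assert (Hb : forall s, 0 <= s < 1 -> ex_series (fun n => Cmod (b n) * s ^ n)).
  { apply ex_series_Cmod_disk. intros w Hw. exists (F w). auto. }
  destruct (ex_series_second_derivative (fun n => Cmod (b n)) r Hb
    (fun n => Cmod_ge_0 (b n)) Hr) as [H1 H2].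
  destruct (ex_series_Cmod (fun n => RtoC (INR (S n)) * b (S n) * z ^ n)%C) as [G HG].
  { apply (ex_series_le (K := R_AbsRing) (V := R_CompleteNormedModule) _ _) with (2 := H1).
    intros n. change (Rabs (Cmod (RtoC (INR (S n)) * b (S n) * z ^ n)) <= INR (S n) * Cmod (b (S n)) * r ^ n).
    rewrite Rabs_pos_eq by apply Cmod_ge_0. rewrite !Cmod_mult, Cmod_R, Cmod_pow, Rabs_pos_eq by apply pos_INR.
    apply Rmult_le_compat_l. apply Rmult_le_pos; [apply pos_INR|apply Cmod_ge_0].
    apply pow_incr. unfold r; lra. }
  set (M := Series (fun n => INR (S n) * INR (S (S n)) * Cmod (b (S (S n))) * r ^ n)).
  assert (K : forall w, Cmod w <= r -> Cmod (F w - F z - G * (w - z)) <= M * Cmod (w - z) ^ 2).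
  { intros w Hw. unfold M. rewrite <- Series_scal_r.
    assert (HS : is_seriesC (fun n => b (S (S n)) * (w ^ S (S n) - z ^ S (S n)
         - RtoC (INR (S (S n))) * z ^ S n * (w - z)))%C (F w - F z - G * (w - z))%C).
    { pose proof (is_seriesC_minus _ _ _ _ (HF w ltac:(unfold in_disk; lra)) (HF z Hz)) as A.
      (* Two leading terms are dropped, here and in [D]: the second-order remainder of [w^n] at [z]
         vanishes for [n = 0] and [n = 1]. *)
      apply is_seriesC_tail in A. pose proof (is_seriesC_mult (w - z)%C _ _ HG) as B.
      pose proof (is_seriesC_tail _ _ (is_seriesC_minus _ _ _ _ A B)) as D.
      match type of D with is_series _ ?l => replace (F w - F z - G * (w - z))%C with l by (simpl; ring) end.
      eapply is_seriesC_ext; [|exact D]. intros n. cbv beta.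
      simpl Cpow. rewrite !S_INR, !RtoC_plus. ring. }
    apply (is_seriesC_mod_le _ _ _ HS).
    - intros n. rewrite Cmod_mult.
      pose proof (Cpow_taylor2 z w r n ltac:(unfold r; lra) Hw) as T.
      pose proof (Cmod_ge_0 (b (S (S n)))) as P.
      apply (Rmult_le_compat_l _ _ _ P) in T. eapply Rle_trans; [exact T|]. right; ring.
    - now apply ex_series_scal_r. }
  rewrite (is_C_derive_unique F z G); auto.
  split; [apply is_linear_scal_l|].
  intros x Hx. apply (is_filter_lim_locally_unique (K := C_AbsRing) (V := AbsRing_NormedModule C_AbsRing)) in Hx. subst x.
  intros eps. apply (locally_norm_le_locally (K := C_AbsRing) (V := AbsRing_NormedModule C_AbsRing)).
  assert (HM : 0 <= Rabs M) by apply Rabs_pos.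
  (* The first bound keeps [|w| <= r], so that [K] applies; the second makes [M |w - z| <= eps]. *)
  assert (Hd : 0 < Rmin ((1 - Cmod z) / 2) (eps / (Rabs M + 1))).
  { apply Rmin_glb_lt; [lra|]. apply Rdiv_lt_0_compat; [apply cond_pos|lra]. }
  exists (mkposreal _ Hd). intros w Hw.
  change (Cmod (w - z) < Rmin ((1 - Cmod z) / 2) (eps / (Rabs M + 1))) in Hw.
  change (Cmod ((F w - F z) - (w - z) * G) <= eps * Cmod (w - z)).
  assert (Hw1 : Cmod (w - z) < (1 - Cmod z) / 2) by (eapply Rlt_le_trans; [exact Hw|apply Rmin_l]).
  assert (Hw2 : Cmod (w - z) < eps / (Rabs M + 1)) by (eapply Rlt_le_trans; [exact Hw|apply Rmin_r]).
  rewrite (Cmult_comm (w - z) G). eapply Rle_trans; [apply K|].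
  - replace w with (z + (w - z))%C by ring. eapply Rle_trans; [apply Cmod_triangle|]. unfold r; lra.
  - pose proof (Cmod_ge_0 (w - z)) as P.
    apply (Rmult_lt_compat_r (Rabs M + 1)) in Hw2; [|lra].
    unfold Rdiv in Hw2. rewrite Rmult_assoc, Rinv_l, Rmult_1_r in Hw2 by lra.
    pose proof (Rle_abs M). pose proof (cond_pos eps). nra.
Qed.

(** The coefficient of [z^n] in [(1 - z^2) f'], namely [(n+1) a_(n+1) - (n-1) a_(n-1)]; the product
    with [z^2] contributes from [n = 2] on. *)
Definition p_coeff (a : nat -> C) (n : nat) : C :=
  (RtoC (INR (S n)) * a (S n) -
   match n with S (S m) => RtoC (INR (S m)) * a (S m) | _ => RtoC 0 end)%C.

Lemma is_series_p_coeff (a : nat -> C) (f : C -> C) (z : C) :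
  (forall w, in_disk w -> is_pseries1 a w (f w)) -> in_disk z ->
  is_seriesC (fun n => p_coeff a n * z ^ n)%C ((1 - z ^ 2) * C_derive f z)%C.
Proof.
  intros Hf Hz.
  (* [is_pseries1] starts at index 1; a zero coefficient at index 0 turns it into an ordinary power
     series. *)
  assert (HF : forall w, in_disk w ->
    is_seriesC (fun n => (match n with O => RtoC 0 | _ => a n end) * w ^ n)%C (f w)).
  { intros w Hw. replace (f w) with (0 * w ^ 0 + f w)%C by ring.
    apply (is_seriesC_cons (fun n => (match n with O => RtoC 0 | _ => a n end) * w ^ n)%C).
    exact (Hf w Hw). }
  pose proof (C_derive_power_series _ f z HF Hz) as D. cbv iota in D.
  pose proof (is_seriesC_mult (z ^ 2)%C _ _ D) as D2.
  (* The series of [z^2 f'] is that of [f'] shifted by two places, hence the two prepended zeros. *)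
  assert (D3 : is_seriesC (fun n => match n with S (S m) => RtoC (INR (S m)) * a (S m) * z ^ n | _ => RtoC 0 end)%C
     (0 + (0 + (z ^ 2 * C_derive f z)))%C).
  { apply (is_seriesC_cons (fun n => match n with S (S m) => RtoC (INR (S m)) * a (S m) * z ^ n | _ => RtoC 0 end)%C).
    apply (is_seriesC_cons (fun n => match n with S m => RtoC (INR (S m)) * a (S m) * z ^ S n | _ => RtoC 0 end)%C).
    eapply is_seriesC_ext; [|exact D2]. intros n. cbv beta iota. simpl Cpow. ring. }
  pose proof (is_seriesC_minus _ _ _ _ D D3) as E.
  match type of E with is_series _ ?l =>
    replace ((1 - z ^ 2) * C_derive f z)%C with l by ring end.
  eapply is_seriesC_ext; [|exact E]. intros n. unfold p_coeff. cbv beta iota.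
  destruct n as [|[|n]]; ring.
Qed.

(** * Finite complex sums and roots of unity *)

(** Sums over [C_AbelianMonoid] can leave an equality typed at the carrier of that structure;
    restating it at [C] lets [ring] find the field. *)
Ltac cring := match goal with |- @eq _ ?a ?b => change (@eq C a b) end; ring.

Lemma csum_mult_l (c : C) (u : nat -> C) (n : nat) :
  csum (fun k => c * u k)%C n = (c * csum u n)%C.
Proof. exact (sum_n_mult_l (K := C_Ring) c u n). Qed.

Lemma csum_mult_r (c : C) (u : nat -> C) (n : nat) :
  csum (fun k => u k * c)%C n = (csum u n * c)%C.
Proof. exact (sum_n_mult_r (K := C_Ring) c u n). Qed.

Lemma csum_S (u : nat -> C) (n : nat) : csum u (S n) = (csum u n + u (S n))%C.
Proof. exact (sum_Sn u n). Qed.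

Lemma csum_const (c : C) (n : nat) : csum (fun _ => c) n = (RtoC (INR (S n)) * c)%C.
Proof.
  induction n as [|n IH]; [rewrite sum_O; simpl; cring|].
  rewrite csum_S, IH, (S_INR (S n)), RtoC_plus. cring.
Qed.

(** Multiplying the sum by [x - 1] telescopes it to [x^(M+1) - 1 = 0]. *)
Lemma csum_geom_root (x : C) (M : nat) :
  (x ^ S M)%C = RtoC 1 -> x <> RtoC 1 -> csum (fun l => x ^ l)%C M = RtoC 0.
Proof.
  intros H1 H2.
  assert (E : forall n, ((x - 1) * csum (fun l => x ^ l)%C n = x ^ S n - 1)%C).
  { induction n as [|n IH]; [rewrite sum_O; simpl; cring|].
    rewrite csum_S, Cmult_plus_distr_l, IH. simpl. cring. }
  specialize (E M). rewrite H1 in E.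
  destruct (Ceq_dec (csum (fun l => x ^ l)%C M) 0) as [e|e]; auto.
  exfalso. apply H2.
  assert (Z : ((x - 1) * csum (fun l => x ^ l)%C M = 0)%C) by (rewrite E; ring).
  destruct (Ceq_dec (x - 1) 0) as [e'|e'].
  - replace x with (x - 1 + 1)%C by ring. rewrite e'. ring.
  - exfalso. exact (Cmult_neq_0 _ _ e' e Z).
Qed.

Definition cis (t : R) : C := (cos t, sin t).

Lemma cis_pow (t : R) (n : nat) : (cis t ^ n)%C = cis (INR n * t).
Proof.
  induction n as [|n IH].
  - unfold cis. simpl. rewrite Rmult_0_l, cos_0, sin_0. reflexivity.
  - simpl Cpow. rewrite IH, S_INR, Rmult_plus_distr_r, Rmult_1_l.
    unfold cis, Cmult. simpl. rewrite cos_plus, sin_plus. f_equal; ring.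
Qed.

Lemma Cmod_cis (t : R) : Cmod (cis t) = 1.
Proof.
  unfold Cmod, cis. simpl fst; simpl snd. rewrite <- sqrt_1. f_equal.
  pose proof (sin2_cos2 t). unfold Rsqr in *. lra.
Qed.

Lemma cis_neq_1 (t : R) : 0 < t < 2 * PI -> cis t <> RtoC 1.
Proof.
  intros Ht E. injection E as Ec _.
  replace t with (2 * (t / 2)) in Ec by lra. rewrite cos_2a_sin in Ec.
  assert (0 < sin (t / 2)) by (apply sin_gt_0; lra). nra.
Qed.

Lemma Cmult_conj_unit (z : C) : Cmod z = 1 -> (z * Cconj z = 1)%C.
Proof. intros H. rewrite <- Cmod2_conj, H. now rewrite pow1. Qed.

(** Orthogonality of the powers of a primitive root of unity [w] of order [M + 1]. As [Cconj w]
    inverts [w], the sum is geometric of ratio [w^(n-k)], and this ratio differs from 1 unless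
    [n = k], because [|n - k| <= M]. *)
Lemma root_average (M n k : nat) : (n <= M)%nat -> (k <= M)%nat ->
  csum (fun l => (cis (2 * PI / INR (S M)) ^ l) ^ n * Cconj (cis (2 * PI / INR (S M)) ^ l) ^ k)%C M
  = if Nat.eq_dec n k then RtoC (INR (S M)) else RtoC 0.
Proof.
  intros Hn Hk. set (w := cis _).
  assert (HM : 0 < INR (S M)) by (apply lt_0_INR; lia).
  assert (Hw : (w * Cconj w = 1)%C) by apply Cmult_conj_unit, Cmod_cis.
  assert (H1 : (w ^ S M = 1)%C).
  { unfold w. rewrite cis_pow. replace (INR (S M) * (2 * PI / INR (S M))) with (2 * PI) by (field; lra).
    unfold cis. now rewrite cos_2PI, sin_2PI. }
  assert (H0 : forall m, (0 < m <= M)%nat -> (w ^ m)%C <> RtoC 1).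
  { intros m Hm. unfold w. rewrite cis_pow. apply cis_neq_1.
    assert (0 < INR m) by (apply lt_0_INR; lia).
    assert (INR m < INR (S M)) by (apply lt_INR; lia).
    pose proof PI_RGT_0 as HP.
    assert (D : 0 < 2 * PI / INR (S M)) by (apply Rdiv_lt_0_compat; lra).
    split; [apply Rmult_lt_0_compat; auto|].
    replace (2 * PI) with (INR (S M) * (2 * PI / INR (S M))) at 2 by (field; lra).
    now apply Rmult_lt_compat_r. }
  assert (P : forall (x : C) (i j : nat), ((x ^ i) ^ j = (x ^ j) ^ i)%C).
  { intros x i j. now rewrite <- !Cpow_mult_r, Nat.mul_comm. }
  rewrite (sum_n_ext (G := C_AbelianMonoid) _ (fun l => (w ^ n * Cconj w ^ k) ^ l)%C).
  2:{ intros l. rewrite Cpow_mult_l, Cpow_conj, (P w), (P (Cconj w)). reflexivity. }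
  destruct (Nat.eq_dec n k) as [<-|E].
  - rewrite <- Cpow_mult_l, Hw, Cpow_1_l.
    rewrite (sum_n_ext (G := C_AbelianMonoid) _ (fun _ => RtoC 1)) by (intros; apply Cpow_1_l).
    rewrite csum_const. cring.
  - apply csum_geom_root.
    + rewrite Cpow_mult_l, P, (P (Cconj w)), <- Cpow_conj, H1, Cpow_1_l.
      replace (Cconj 1) with (RtoC 1) by (unfold Cconj, RtoC; simpl; f_equal; ring).
      rewrite Cpow_1_l. ring.
    (* A ratio equal to 1 would force [w^|n-k| = 1]; for [n < k] the relation found concerns the
       conjugate and is conjugated back. *)
    + intros A. destruct (Nat.lt_ge_cases n k) as [L|L].
      * apply (H0 (k - n)%nat ltac:(lia)).
        replace k with (n + (k - n))%nat in A by lia.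
        rewrite Cpow_add_r, Cmult_assoc, <- Cpow_mult_l, Hw, Cpow_1_l, Cmult_1_l in A.
        rewrite <- (Cconj_conj (w ^ (k - n))), Cpow_conj, A.
        unfold Cconj, RtoC; simpl; f_equal; ring.
      * apply (H0 (n - k)%nat ltac:(lia)).
        replace n with ((n - k) + k)%nat in A by lia.
        rewrite Cpow_add_r, <- Cmult_assoc, <- Cpow_mult_l, Hw, Cpow_1_l, Cmult_1_r in A.
        exact A.
Qed.

(** * The Toeplitz form *)

(* The real part is the Hermitian form of the Toeplitz matrix with diagonal
   entries [b 0] and off-diagonal entries [b k / 2] (when [b 0] is real). *)
Definition toeplitz_form (b : nat -> C) (l0 l1 l2 l3 : C) : C :=
  (b 0%nat * (l0 * Cconj l0 + l1 * Cconj l1 + l2 * Cconj l2 + l3 * Cconj l3)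
   + b 1%nat * (l0 * Cconj l1 + l1 * Cconj l2 + l2 * Cconj l3)
   + b 2%nat * (l0 * Cconj l2 + l1 * Cconj l3)
   + b 3%nat * (l0 * Cconj l3))%C.

Lemma csum_plus (u v : nat -> C) (n : nat) :
  csum (fun k => u k + v k)%C n = (csum u n + csum v n)%C.
Proof. exact (sum_n_plus (G := C_AbelianMonoid) u v n). Qed.

Lemma csum_zero_tail (u : nat -> C) (N m : nat) :
  (forall n, (N < n)%nat -> u n = RtoC 0) -> csum u (N + m) = csum u N.
Proof.
  intros H. induction m as [|m IH]; [now rewrite Nat.add_0_r|].
  rewrite Nat.add_succ_r, csum_S, IH, H by lia. cring.
Qed.

Lemma Re_csum (u : nat -> C) (n : nat) : Re (csum u n) = sum_n (fun k => Re (u k)) n.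
Proof.
  induction n as [|n IH]; [now rewrite !sum_O|]. rewrite csum_S, sum_Sn, <- IH. reflexivity.
Qed.

Lemma sum_n_nonneg (u : nat -> R) (n : nat) : (forall k, 0 <= u k) -> 0 <= sum_n u n.
Proof.
  intros H. induction n as [|n IH]; [rewrite sum_O; auto|]. rewrite sum_Sn.
  specialize (H (S n)). change (plus ?a ?b) with (a + b). lra.
Qed.

Lemma re_mult_R (r : R) (z : C) : Re (RtoC r * z) = r * Re z.
Proof. unfold Re. simpl. ring. Qed.

(* Average [Re P |q|^2], [q(z) = l0 + l1 z + l2 z^2 + l3 z^3], over the
   roots of unity of an order exceeding all exponents. *)
Lemma toeplitz_poly (b : nat -> C) (m : nat) (l0 l1 l2 l3 : C) :
  (forall z, Cmod z = 1 -> 0 <= Re (csum (fun n => b n * z ^ n)%C (3 + m))) ->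
  0 <= Re (toeplitz_form b l0 l1 l2 l3).
Proof.
  intros H.
  set (M := (6 + m)%nat). set (w := cis (2 * PI / INR (S M))).
  set (q := fun z : C => (l0 + l1 * z ^ 1 + l2 * z ^ 2 + l3 * z ^ 3)%C).
  set (q' := fun z : C => (Cconj l0 * Cconj z ^ 0 + Cconj l1 * Cconj z ^ 1
                           + Cconj l2 * Cconj z ^ 2 + Cconj l3 * Cconj z ^ 3)%C).
  assert (Hq : forall z, q' z = Cconj (q z)).
  { intros z. unfold q, q'. rewrite !Cplus_conj, !Cmult_conj, !Cpow_conj. ring. }
  assert (HM : 0 < INR (S M)) by (apply lt_0_INR; lia).
  assert (E : csum (fun l => csum (fun n => b n * (w ^ l) ^ n) (3 + m) * (q (w ^ l) * q' (w ^ l)))%C M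
     = (RtoC (INR (S M)) * toeplitz_form b l0 l1 l2 l3)%C).
  { rewrite (sum_n_ext (G := C_AbelianMonoid) _
      (fun l => csum (fun n => b n * ((w ^ l) ^ n * (q (w ^ l) * q' (w ^ l)))) (3 + m))%C).
    2:{ intros l. rewrite <- csum_mult_r. apply sum_n_ext. intros n. cring. }
    rewrite (sum_n_switch (G := C_AbelianMonoid)
      (fun l n => b n * ((w ^ l) ^ n * (q (w ^ l) * q' (w ^ l))))%C).
    set (mo := fun n k : nat => if Nat.eq_dec n k then RtoC (INR (S M)) else RtoC 0).
    assert (A : forall n, (n <= 3 + m)%nat ->
       csum (fun l => b n * ((w ^ l) ^ n * (q (w ^ l) * q' (w ^ l))))%C M =
       (b n * (l0 * (Cconj l0 * mo n 0%nat + Cconj l1 * mo n 1%nat + Cconj l2 * mo n 2%nat + Cconj l3 * mo n 3%nat)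
       + l1 * (Cconj l0 * mo (n + 1)%nat 0%nat + Cconj l1 * mo (n + 1)%nat 1%nat + Cconj l2 * mo (n + 1)%nat 2%nat + Cconj l3 * mo (n + 1)%nat 3%nat)
       + l2 * (Cconj l0 * mo (n + 2)%nat 0%nat + Cconj l1 * mo (n + 2)%nat 1%nat + Cconj l2 * mo (n + 2)%nat 2%nat + Cconj l3 * mo (n + 2)%nat 3%nat)
       + l3 * (Cconj l0 * mo (n + 3)%nat 0%nat + Cconj l1 * mo (n + 3)%nat 1%nat + Cconj l2 * mo (n + 3)%nat 2%nat + Cconj l3 * mo (n + 3)%nat 3%nat)))%C).
    { intros n Hn. unfold mo. rewrite <- !(root_average M) by (unfold M; lia). fold w.
      rewrite csum_mult_l. f_equal. rewrite <- !csum_mult_l, <- !csum_plus, <- !csum_mult_l, <- !csum_plus.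
      apply sum_n_ext. intros l. unfold q, q'. rewrite !Cpow_add_r. cring. }
    rewrite (sum_n_ext_loc (G := C_AbelianMonoid) _ _ _ A).
    (* [mo (n + i) j] with [j <= 3] vanishes as soon as [n > 3], so only [b 0] to [b 3] survive the
       averaging. *)
    rewrite csum_zero_tail.
    - rewrite !csum_S, sum_O. unfold mo, toeplitz_form. simpl Nat.add. simpl Nat.eq_dec. cbv iota. cring.
    - intros n Hn. unfold mo. do 16 (destruct (Nat.eq_dec _ _); [lia|]). cring. }
  assert (P : 0 <= Re (RtoC (INR (S M)) * toeplitz_form b l0 l1 l2 l3)).
  { rewrite <- E, Re_csum. apply sum_n_nonneg. intros l.
    rewrite Hq, <- Cmod2_conj, Cmult_comm, re_mult_R.
    apply Rmult_le_pos; [apply pow2_ge_0|]. apply H.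
    rewrite Cmod_pow. unfold w. now rewrite Cmod_cis, pow1. }
  rewrite re_mult_R in P. apply Rmult_le_reg_l with (INR (S M)); auto. now rewrite Rmult_0_r.
Qed.

Lemma is_seriesC_remainder (u : nat -> C) (l : C) (n : nat) :
  is_seriesC u l -> is_seriesC (fun k => u (S n + k)%nat) (l - csum u n)%C.
Proof.
  intros H. induction n as [|n IH].
  - rewrite sum_O. exact (is_seriesC_tail u l H).
  - rewrite csum_S. apply is_seriesC_tail in IH.
    rewrite Nat.add_0_r in IH.
    replace (l - (csum u n + u (S n)))%C with (l - csum u n - u (S n))%C by cring.
    eapply is_seriesC_ext; [|exact IH]. intros k. cbv beta. f_equal. lia.
Qed.

(** Reduction to polynomials. If the tail beyond degree [3 + m] has absolute sum at most [d], the
    truncation has real part at least [-d] on the circle; adding [d] to [b 0] repairs this and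
    changes the form by [d K], with [K] the squared norm of the vector, which is arbitrarily
    small. *)
Lemma toeplitz_series (b : nat -> C) (l0 l1 l2 l3 : C) :
  ex_series (fun n => Cmod (b n)) ->
  (forall z, Cmod z = 1 -> exists p, is_seriesC (fun n => b n * z ^ n)%C p /\ 0 <= Re p) ->
  0 <= Re (toeplitz_form b l0 l1 l2 l3).
Proof.
  intros Hb Hp.
  set (K := Re (l0 * Cconj l0 + l1 * Cconj l1 + l2 * Cconj l2 + l3 * Cconj l3)).
  assert (HK : 0 <= K).
  { unfold K. simpl. nra. }
  apply le_epsilon. intros e He. rewrite Rplus_comm.
  set (d := e / (K + 1)). assert (Hd : 0 < d) by (apply Rdiv_lt_0_compat; lra).
  assert (Hdk : d * K <= e).
  { unfold d. apply Rmult_le_reg_r with (K + 1); [lra|]. field_simplify; [|lra]. nra. }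
  assert (T : exists m, Series (fun k => Cmod (b (S (3 + m) + k)%nat)) <= d).
  { apply Series_correct in Hb as S.
    destruct (proj1 (filterlim_locally _ _) S (mkposreal d Hd)) as [m Hm].
    exists m. specialize (Hm (3 + m)%nat ltac:(lia)).
    rewrite (Series_incr_n _ (Datatypes.S (3 + m))) in Hm; [|lia|exact Hb].
    rewrite <- sum_n_Reals in Hm. simpl Init.Nat.pred in Hm.
    change (Rabs (sum_n (fun n => Cmod (b n)) (3 + m) -
     (sum_n (fun n => Cmod (b n)) (3 + m) + Series (fun k => Cmod (b (Datatypes.S (3 + m) + k)%nat)))) < d) in Hm.
    apply Rabs_def2 in Hm. lra. }
  destruct T as [m Hm].
  set (b' := fun n => match n with O => (b 0%nat + RtoC d)%C | _ => b n end).
  assert (P : 0 <= Re (toeplitz_form b' l0 l1 l2 l3)).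
  { apply (toeplitz_poly b' m). intros z Hz.
    destruct (Hp z Hz) as [p [H1 H2]].
    assert (E : forall k, csum (fun n => b' n * z ^ n)%C k = (RtoC d + csum (fun n => b n * z ^ n)%C k)%C).
    { intros k. induction k as [|n IH]; [rewrite !sum_O; simpl; cring|].
      rewrite !csum_S, IH. simpl b'. cring. }
    rewrite E. pose proof (is_seriesC_remainder _ _ (3 + m) H1) as H3.
    apply is_seriesC_mod_le with (v := fun k => Cmod (b (S (3 + m) + k)%nat)) in H3.
    - set (s := csum _ _) in *. pose proof (re_le_Cmod (p - s)%C) as H4.
      apply Rabs_le_between in H4.
      change (Re (p - s)%C) with (Re p - Re s) in H4.
      change (Re (RtoC d + s)%C) with (d + Re s). lra.
    - intros k. rewrite Cmod_mult, Cmod_pow, Hz, pow1. lra.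
    - now apply (ex_series_incr_n (fun n => Cmod (b n)) (S (3 + m))). }
  assert (E : toeplitz_form b' l0 l1 l2 l3 = (toeplitz_form b l0 l1 l2 l3 +
    RtoC d * (l0 * Cconj l0 + l1 * Cconj l1 + l2 * Cconj l2 + l3 * Cconj l3))%C).
  { unfold toeplitz_form, b'. ring. }
  rewrite E in P.
  change (0 <= Re (toeplitz_form b l0 l1 l2 l3) + Re (RtoC d * (l0 * Cconj l0 + l1 * Cconj l1 + l2 * Cconj l2 + l3 * Cconj l3))) in P.
  rewrite re_mult_R in P. fold K in P. lra.
Qed.

(** * Coefficient bounds from positivity of the form *)

Lemma unit_phase (z : C) : exists u : C, Cmod u = 1 /\ (u * z = RtoC (Cmod z))%C.
Proof.
  destruct (Ceq_dec z 0) as [->|Hz].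
  - exists (RtoC 1). rewrite Cmod_1, Cmod_0. split; [lra|ring].
  - apply Cmod_gt_0 in Hz as Hp.
    assert (Hm : RtoC (Cmod z) <> RtoC 0) by (intros A; apply RtoC_inj in A; lra).
    exists (Cconj z / RtoC (Cmod z))%C. split.
    + rewrite Cmod_div, Cmod_conj, Cmod_R, Rabs_pos_eq by (auto; lra). field; lra.
    + replace (Cconj z / Cmod z * z)%C with ((z * Cconj z) / Cmod z)%C by (field; auto).
      rewrite <- Cmod2_conj. simpl (Cmod z ^ 2). rewrite !RtoC_mult. field. auto.
Qed.

Lemma re_RtoC (r : R) : Re (RtoC r) = r.
Proof. reflexivity. Qed.

Definition toeplitz_nonneg (b : nat -> C) : Prop :=
  forall l0 l1 l2 l3, 0 <= Re (toeplitz_form b l0 l1 l2 l3).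

(** At the vector [(-u, 1, 0, 0)], with [u] the phase for which [u b_1 = |b_1|], the form takes the
    value [2 - |b_1|]. *)
Lemma toeplitz_b1 (b : nat -> C) :
  toeplitz_nonneg b -> b 0%nat = RtoC 1 -> Cmod (b 1%nat) <= 2.
Proof.
  intros H H0. destruct (unit_phase (b 1%nat)) as [u [Hu Eu]].
  pose proof (H (- u)%C (RtoC 1) (RtoC 0) (RtoC 0)) as P.
  assert (E : toeplitz_form b (- u) 1 0 0 = (2 - Cmod (b 1%nat))%C).
  { unfold toeplitz_form. rewrite H0, <- Eu.
    pose proof (Cmult_conj_unit u Hu) as U. rewrite Copp_conj.
    replace (Cconj 1) with (RtoC 1) by (unfold Cconj, RtoC; simpl; f_equal; ring).
    replace (Cconj 0) with (RtoC 0) by (unfold Cconj, RtoC; simpl; f_equal; ring).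
    transitivity (1 + u * Cconj u - u * b 1%nat)%C; [ring|]. rewrite U. ring. }
  rewrite E in P. simpl in P. lra.
Qed.

(* [u = (1, -t, 0, 0)] and [v = (0, -t, 1, 0)] have equal norms and are both
   orthogonal to the second basis vector; test the form at [a u + v]. *)
Lemma toeplitz_b2 (b : nat -> C) (t : R) (y : C) :
  toeplitz_nonneg b -> b 0%nat = RtoC 1 -> b 1%nat = RtoC (2 * t) ->
  b 2%nat = (2 * y)%C -> Cmod (y - RtoC (t ^ 2)) <= 1 - t ^ 2.
Proof.
  intros H H0 H1 H2. destruct (unit_phase (y - RtoC (t ^ 2))) as [u [Hu Eu]].
  pose proof (H (- u)%C (- RtoC t * (1 - u))%C (RtoC 1) (RtoC 0)) as P.
  pose proof (Cmod2_alt u) as U. rewrite Hu in U.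
  assert (E : Re (toeplitz_form b (- u) (- RtoC t * (1 - u)) 1 0)
    = (Re u ^ 2 + Im u ^ 2 + 1) * (1 - t ^ 2) - 2 * Re (u * (y - RtoC (t ^ 2)))).
  { unfold toeplitz_form. rewrite H0, H1, H2. destruct u, y. unfold Re, Im. simpl. ring. }
  rewrite E, Eu, re_RtoC, <- U in P. lra.
Qed.

(* [u = (1, -t (1 - x), -x, 0)] and its mirror image [v] have squared norm
   [(1 - t^2) (1 - |x|^2)] and are orthogonal to the two middle basis vectors. *)
Lemma toeplitz_b3 (b : nat -> C) (t : R) (x s : C) :
  toeplitz_nonneg b -> b 0%nat = RtoC 1 -> b 1%nat = RtoC (2 * t) ->
  b 2%nat = (2 * (RtoC (t ^ 2) + RtoC (1 - t ^ 2) * x))%C -> b 3%nat = (2 * s)%C ->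
  Cmod (s - (RtoC (t ^ 3) + RtoC (2 * t * (1 - t ^ 2)) * x - RtoC (t * (1 - t ^ 2)) * x ^ 2))
    <= (1 - t ^ 2) * (1 - Cmod x ^ 2).
Proof.
  intros H H0 H1 H2 H3. set (k := (_ - _ * x ^ 2)%C).
  destruct (unit_phase (s - k)) as [u [Hu Eu]].
  (* Here [u] is the phase making [u (s - k)] equal to [|s - k|]. The test vector is [-u] times the
     vector [(1, -t (1 - x), -x, 0)], plus the mirror image of the latter; the cross term of the two
     is [-2 Re (u (s - k))]. *)
  pose proof (H (- u)%C (u * RtoC t * (1 - x) - Cconj x)%C
                (u * x - RtoC t * (1 - Cconj x))%C (RtoC 1)) as P.
  pose proof (Cmod2_alt u) as U. rewrite Hu in U.
  assert (E : Re (toeplitz_form b (- u) (u * RtoC t * (1 - x) - Cconj x)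
                (u * x - RtoC t * (1 - Cconj x)) 1)
    = (Re u ^ 2 + Im u ^ 2 + 1) * ((1 - t ^ 2) * (1 - Cmod x ^ 2)) - 2 * Re (u * (s - k))).
  { rewrite (Cmod2_alt x). unfold toeplitz_form, k. rewrite H0, H1, H2, H3.
    destruct u, x, s. unfold Re, Im. simpl. ring. }
  rewrite E, Eu, re_RtoC, <- U in P. lra.
Qed.

(** Writing [b_2 = 2 (t^2 + D x)] with [|x| <= 1] and [b_3 = 2 s] with [s] in a disk of centre [k]
    and radius [D (1 - |x|^2)], the functional becomes [12 (s - k) + 4 t^3 + 8 t D x - 12 t D x^2].
    The triangle inequality leaves a quadratic in [r = |x|], which is then maximised. *)
Lemma toeplitz_functional (b : nat -> C) (t : R) :
  toeplitz_nonneg b -> b 0%nat = RtoC 1 -> b 1%nat = RtoC (2 * t) -> 0 <= t < 1 ->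
  Cmod (6 * b 3%nat - 4 * b 1%nat * b 2%nat + b 1%nat ^ 3)
    <= 12 - 32 / 3 * t ^ 2 + 16 / 3 * t ^ 3.
Proof.
  intros H H0 H1 Ht. set (D := 1 - t ^ 2). assert (HD : 0 < D) by (unfold D; nra).
  assert (HDC : RtoC D <> RtoC 0) by (intros A; apply RtoC_inj in A; lra).
  set (y := (b 2%nat / 2)%C). set (s := (b 3%nat / 2)%C).
  set (x := ((y - RtoC (t ^ 2)) / RtoC D)%C).
  assert (Ey : b 2%nat = (2 * y)%C) by (unfold y; field; intros A; apply RtoC_inj in A; lra).
  assert (Es : b 3%nat = (2 * s)%C) by (unfold s; field; intros A; apply RtoC_inj in A; lra).
  assert (Ex : y = (RtoC (t ^ 2) + RtoC D * x)%C) by (unfold x; field; auto).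
  pose proof (toeplitz_b2 b t y H H0 H1 Ey) as B2.
  assert (Hx : Cmod x <= 1).
  { unfold x. rewrite Cmod_div, Cmod_R, Rabs_pos_eq by (auto; lra).
    apply Rmult_le_reg_r with D; auto. unfold Rdiv. rewrite Rmult_assoc, Rinv_l by lra. fold D in B2. lra. }
  rewrite Ex in Ey.
  pose proof (toeplitz_b3 b t x s H H0 H1 Ey Es) as B3. fold D in B3.
  set (k := (_ - _ * x ^ 2)%C) in B3.
  replace (6 * b 3%nat - 4 * b 1%nat * b 2%nat + b 1%nat ^ 3)%C with
    (12 * (s - k) + (RtoC (4 * t ^ 3) + RtoC (8 * t * D) * x - RtoC (12 * t * D) * x ^ 2))%C.
  2:{ unfold k. rewrite H1, Ey, Es, !RtoC_mult, !RtoC_pow.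
      cut (forall u v : C, (u - v = 0)%C -> u = v).
      - intros Z. apply Z. unfold D. rewrite RtoC_minus, RtoC_pow. ring.
      - intros u v Z. replace u with (u - v + v)%C by ring. rewrite Z. ring. }
  pose proof (Cmod_ge_0 x) as Hx0. set (r := Cmod x) in *.
  assert (T : Cmod (RtoC (4 * t ^ 3) + RtoC (8 * t * D) * x - RtoC (12 * t * D) * x ^ 2)
     <= 4 * t ^ 3 + 8 * t * D * r + 12 * t * D * r ^ 2).
  { assert (P : 0 <= t * D) by nra. assert (P3 : 0 <= t ^ 3) by (apply pow_le; lra).
    eapply Rle_trans; [apply Cmod_triangle|]. rewrite Cmod_opp.
    eapply Rle_trans; [apply Rplus_le_compat_r, Cmod_triangle|].
    rewrite !Cmod_mult, !Cmod_pow, !Cmod_R, !Rabs_pos_eq by lra. fold r. lra. }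
  eapply Rle_trans; [apply Cmod_triangle|]. rewrite Cmod_mult, Cmod_R, Rabs_pos_eq by lra.
  (* The quadratic [8 t r - 12 (1 - t) r^2] is at most [4 t^2 / (3 (1 - t))]. *)
  assert (Q : D * (8 * t * r - 12 * (1 - t) * r ^ 2) <= 4 / 3 * t ^ 2 * (1 + t)).
  { replace D with ((1 - t) * (1 + t)) by (unfold D; ring).
    (* The square vanishes at the vertex [r = t / (3 (1 - t))]; times [4/3 (1 + t)] it is the
       difference of the two sides. *)
    pose proof (pow2_ge_0 (3 * (1 - t) * r - t)) as S.
    assert (S' : 0 <= 1 + t) by lra. pose proof (Rmult_le_pos _ _ S' S). lra. }
  assert (N : 12 * (D * (1 - r ^ 2)) + (4 * t ^ 3 + 8 * t * D * r + 12 * t * D * r ^ 2)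
    = 12 * D + 4 * t ^ 3 + D * (8 * t * r - 12 * (1 - t) * r ^ 2)) by ring.
  unfold D in *. nra.
Qed.

(** The left side is the cubic [12 + 2 c - (8/3) c^2 + (2/3) c^3] at [c = 2 t]. Besides the double
    root, the difference has the root [(2 + q) / 3], which is at least 4/3 and so lies beyond the
    interval. *)
Lemma gamma3_cubic_bound (t : R) : 0 <= t <= 1 ->
  12 + 4 * t - 32 / 3 * t ^ 2 + 16 / 3 * t ^ 3 <= 48 * gamma3_bound.
Proof.
  intros Ht. unfold gamma3_bound. set (q := sqrt 7).
  assert (Hq : q * q = 7) by (apply sqrt_sqrt; lra).
  assert (Hq0 : 0 <= q) by apply sqrt_pos.
  assert (Hq2 : 2 <= q) by nra.
  (* The critical point [(4 - q) / 6] is a double root of the difference. *)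
  assert (E : 48 * ((233 + 7 * q) / 972) - (12 + 4 * t - 32 / 3 * t ^ 2 + 16 / 3 * t ^ 3)
     = 16 / 3 * (t - (4 - q) / 6) ^ 2 * ((2 + q) / 3 - t) + (7 - q * q) * (4 / 9 * t + 4 / 81 * (q - 6))) by field.
  (* The summand with factor [7 - q * q] makes [E] an identity valid for every [q]; it vanishes
     now. *)
  rewrite Hq in E.
  pose proof (pow2_ge_0 (t - (4 - q) / 6)). assert (0 <= (2 + q) / 3 - t) by lra. nra.
Qed.

(** * Coefficients of functions with positive real part *)

Definition caratheodory_coeffs (c : nat -> C) : Prop :=
  c 0%nat = RtoC 1 /\
  forall z, in_disk z -> exists p, is_seriesC (fun n => c n * z ^ n)%C p /\ 0 < Re p.

(** The numbers [c_n w^n] are the coefficients of [p (w z)], whose series converges absolutely on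
    the closed disk because [|w| < 1]. A complex [w] performs the dilation and a rotation at
    once. *)
Lemma caratheodory_toeplitz (c : nat -> C) (w : C) :
  caratheodory_coeffs c -> in_disk w -> toeplitz_nonneg (fun n => c n * w ^ n)%C.
Proof.
  intros [_ Hc] Hw l0 l1 l2 l3. apply toeplitz_series.
  - apply (ex_series_ext (fun n => Cmod (c n) * Cmod w ^ n)).
    + intros n. now rewrite Cmod_mult, Cmod_pow.
    + apply ex_series_Cmod_disk; [|split; [apply Cmod_ge_0|exact Hw]].
      intros z Hz. destruct (Hc z Hz) as [p [Hp _]]. now exists p.
  - intros z Hz. destruct (Hc (w * z)%C) as [p [Hp Hr]].
    { unfold in_disk. now rewrite Cmod_mult, Hz, Rmult_1_r. }
    exists p. split; [|lra]. eapply is_seriesC_ext; [|exact Hp].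
    intros n. cbv beta. rewrite Cpow_mult_l. cring.
Qed.

(** [X] is homogeneous of weight 3: replacing [c_n] by [c_n w^n] multiplies it by [w^3]. With
    [w = r u] and [u c_1 = |c_1|], the first coefficient becomes real while [|X|] only gains [r^3].
    The term [2 c_1] has another weight and enters through its modulus; finally [r] tends to 1. *)
Lemma caratheodory_functional (c : nat -> C) :
  caratheodory_coeffs c ->
  Cmod (2 * c 1%nat + 6 * c 3%nat - 4 * c 1%nat * c 2%nat + c 1%nat ^ 3)
    <= 48 * gamma3_bound.
Proof.
  intros Hc. pose proof (proj1 Hc) as H0.
  set (X := (6 * c 3%nat - 4 * c 1%nat * c 2%nat + c 1%nat ^ 3)%C).
  replace (_ + _)%C with (2 * c 1%nat + X)%C by (unfold X; ring).
  assert (B0 : forall r, 0 <= r < 1 -> r * Cmod (c 1%nat) <= 2).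
  { intros r Hr.
    assert (Hw : in_disk (RtoC r)) by (unfold in_disk; rewrite Cmod_R, Rabs_pos_eq; lra).
    pose proof (toeplitz_b1 _ (caratheodory_toeplitz c _ Hc Hw)) as T. cbv beta in T.
    rewrite Cpow_1_r, Cmod_mult, Cmod_R, Rabs_pos_eq in T by lra.
    rewrite Rmult_comm. apply T. rewrite H0. simpl. ring. }
  pose proof (Cmod_ge_0 (c 1%nat)) as P1. pose proof (Cmod_ge_0 X) as PX.
  assert (B1 : forall r, 0 < r < 1 -> r ^ 3 * (2 * Cmod (c 1%nat) + Cmod X) <= 48 * gamma3_bound).
  { intros r Hr. destruct (unit_phase (c 1%nat)) as [u [Hu Eu]].
    set (t := r * Cmod (c 1%nat) / 2).
    assert (Ht : 0 <= t < 1).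
    { unfold t. specialize (B0 ((1 + r) / 2) ltac:(lra)). split; [nra|].
      destruct (Req_dec (Cmod (c 1%nat)) 0) as [->|]; nra. }
    assert (Hw : in_disk (RtoC r * u)%C).
    { unfold in_disk. rewrite Cmod_mult, Hu, Cmod_R, Rabs_pos_eq; lra. }
    pose proof (toeplitz_functional _ t (caratheodory_toeplitz c _ Hc Hw)) as T. cbv beta in T.
    replace (6 * (c 3%nat * (r * u) ^ 3) - 4 * (c 1%nat * (r * u) ^ 1) * (c 2%nat * (r * u) ^ 2)
              + (c 1%nat * (r * u) ^ 1) ^ 3)%C with ((r * u) ^ 3 * X)%C in T by (unfold X; ring).
    rewrite Cmod_mult, Cmod_pow, Cmod_mult, Hu, Cmod_R, Rabs_pos_eq, Rmult_1_r in T by lra.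
    assert (T' : r ^ 3 * Cmod X <= 12 - 32 / 3 * t ^ 2 + 16 / 3 * t ^ 3).
    { apply T; auto.
      - rewrite H0. simpl. ring.
      - rewrite Cpow_1_r. transitivity (RtoC r * (u * c 1%nat))%C; [ring|].
        rewrite Eu, <- RtoC_mult. f_equal. unfold t. field. }
    pose proof (gamma3_cubic_bound t ltac:(lra)) as G.
    assert (r ^ 3 * (2 * Cmod (c 1%nat)) <= 4 * t).
    { unfold t. assert (r ^ 3 <= r) by (simpl; nra). nra. }
    lra. }
  eapply Rle_trans; [apply Cmod_triangle|]. rewrite Cmod_mult, Cmod_R, Rabs_pos_eq by lra.
  set (K := 2 * Cmod (c 1%nat) + Cmod X) in *. assert (PK : 0 <= K) by (unfold K; lra).
  apply le_epsilon. intros e He.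
  (* With [r = 1 - d], the bound [(1 - d)^3 >= 1 - 3 d] limits the loss to [3 d K <= e]; the value
     1/2 keeps [r] inside [(0, 1)]. *)
  set (d := Rmin (1 / 2) (e / (3 * K + 1))).
  assert (Hd : 0 < d) by (apply Rmin_glb_lt; [lra|apply Rdiv_lt_0_compat; lra]).
  assert (Hd1 : d <= 1 / 2) by apply Rmin_l.
  assert (Hd2 : d * (3 * K + 1) <= e).
  { apply Rle_trans with (e / (3 * K + 1) * (3 * K + 1)).
    - apply Rmult_le_compat_r; [lra|apply Rmin_r].
    - right. field. lra. }
  specialize (B1 (1 - d) ltac:(lra)).
  assert (1 - 3 * d <= (1 - d) ^ 3) by (simpl; nra). nra.
Qed.

Lemma class_F2_coeffs (f : C -> C) (a : nat -> C) :
  a 1%nat = RtoC 1 -> (forall z, in_disk z -> is_pseries1 a z (f z)) ->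
  (forall z, in_disk z -> 0 < Re ((1 - z ^ 2) * C_derive f z)%C) ->
  caratheodory_coeffs (p_coeff a).
Proof.
  intros H1 Hf Hp. split.
  - unfold p_coeff. rewrite H1. simpl. ring.
  - intros z Hz. exists ((1 - z ^ 2) * C_derive f z)%C. split; auto.
    now apply is_series_p_coeff.
Qed.

(** * Asymptotic expansions at [0] *)

(** For [|x| <= 1] the term of index [4 + k] is at most [|x|^4 / k!], so the tail is at most
    [e |x|^4], and [e <= 3]. *)
Lemma exp_taylor3 (x : R) : Rabs x <= 1 ->
  Rabs (exp x - (1 + x + x ^ 2 / 2 + x ^ 3 / 6)) <= 3 * Rabs x ^ 4.
Proof.
  intros Hx.
  pose proof (is_exp_Reals x) as E. apply is_pseries_R in E.
  pose proof (is_exp_Reals 1) as E1. apply is_pseries_R in E1.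
  set (v := fun n => Rabs x ^ 4 * (/ INR (Factorial.fact n) * 1 ^ n)).
  assert (Hv : is_series v (Rabs x ^ 4 * exp 1))
    by exact (is_series_scal (K := R_AbsRing) (V := R_NormedModule) (Rabs x ^ 4) _ _ E1).
  assert (Hle : forall k, 0 <= Rabs (/ INR (Factorial.fact (4 + k)) * x ^ (4 + k)) <= v k).
  { intros k. split; [apply Rabs_pos|]. unfold v.
    rewrite pow1, Rmult_1_r, Rabs_mult, <- RPow_abs, pow_add.
    pose proof (INR_fact_lt_0 k) as F. pose proof (INR_fact_lt_0 (4 + k)) as F4.
    rewrite Rabs_pos_eq by (left; now apply Rinv_0_lt_compat).
    assert (A : / INR (Factorial.fact (4 + k)) <= / INR (Factorial.fact k)).
    { apply Rinv_le_contravar; auto. apply le_INR, Factorial.fact_le. lia. }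
    assert (B : Rabs x ^ k <= 1) by (rewrite <- (pow1 k); apply pow_incr; split; [apply Rabs_pos|auto]).
    pose proof (pow_le _ k (Rabs_pos x)). pose proof (pow_le _ 4 (Rabs_pos x)).
    pose proof (Rinv_0_lt_compat _ F4).
    apply Rle_trans with (/ INR (Factorial.fact k) * (Rabs x ^ 4 * 1)); [|lra].
    apply Rmult_le_compat; try lra; [apply Rmult_le_pos; auto|apply Rmult_le_compat_l; auto]. }
  assert (Ha : ex_series (fun k => Rabs (/ INR (Factorial.fact (4 + k)) * x ^ (4 + k)))).
  { apply (ex_series_le (K := R_AbsRing) (V := R_CompleteNormedModule) _ v).
    - intros k. change (Rabs (Rabs (/ INR (Factorial.fact (4 + k)) * x ^ (4 + k))) <= v k).
      rewrite Rabs_Rabsolu. apply Hle.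
    - eexists; exact Hv. }
  replace (exp x - (1 + x + x ^ 2 / 2 + x ^ 3 / 6))
    with (Series (fun k => / INR (Factorial.fact (4 + k)) * x ^ (4 + k))).
  - eapply Rle_trans; [apply Series_Rabs; exact Ha|].
    eapply Rle_trans; [apply Series_le; [exact Hle|eexists; exact Hv]|].
    rewrite (is_series_unique _ _ Hv). pose proof exp_le_3. pose proof (pow_le _ 4 (Rabs_pos x)). nra.
  - pose proof (is_series_unique _ _ E) as U.
    rewrite (Series_incr_n _ 4) in U; [|lia|eexists; exact E].
    rewrite <- U. simpl. field.
Qed.

Lemma cos_taylor2 (y : R) : Rabs y <= 1 -> Rabs (cos y - (1 - y ^ 2 / 2)) <= Rabs y ^ 4.
Proof.
  intros H. apply Rabs_le_between in H.
  pose proof (pre_cos_bound y 0 ltac:(lra) ltac:(lra)) as [A B].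
  unfold cos_approx, cos_term in A, B. simpl in A, B.
  assert (P : 0 <= y ^ 4) by (replace (y ^ 4) with ((y ^ 2) ^ 2) by ring; apply pow2_ge_0).
  rewrite RPow_abs, (Rabs_pos_eq (y ^ 4)) by exact P. apply Rabs_le. simpl in *. lra.
Qed.

(** For nonnegative arguments, consecutive partial sums of the alternating series bracket [sin];
    oddness gives the rest. *)
Lemma sin_taylor3 (y : R) : Rabs y <= 1 -> Rabs (sin y - (y - y ^ 3 / 6)) <= Rabs y ^ 4.
Proof.
  assert (P : forall z, 0 <= z <= 1 -> Rabs (sin z - (z - z ^ 3 / 6)) <= z ^ 4).
  { intros z Hz. pose proof (pre_sin_bound z 0 ltac:(lra) ltac:(lra)) as [A B].
    unfold sin_approx, sin_term in A, B. simpl in A, B.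
    assert (0 <= z ^ 4) by (apply pow_le; lra).
    assert (z ^ 5 <= z ^ 4) by (simpl in *; nra).
    apply Rabs_le. simpl in *. lra. }
  intros H. unfold Rabs in H |- * at 2. destruct (Rcase_abs y).
  - specialize (P (- y) ltac:(lra)). rewrite sin_neg in P.
    rewrite <- Rabs_Ropp. replace (- (sin y - (y - y ^ 3 / 6))) with (- sin y - (- y - (- y) ^ 3 / 6)) by field.
    exact P.
  - apply P. lra.
Qed.

(** Each component is split into the errors of the real expansions of [exp], [cos], [sin] and
    leftover monomials of degree at least 4, all of order [m^4] since [m <= 1]. The constant is
    deliberately crude: 50 per component, doubled because [sqrt 2 <= 2]. *)
Lemma Cexp_taylor3 : exists K, forall w, Cmod w <= 1 ->
  Cmod (Cexp w - (1 + w + w ^ 2 / 2 + w ^ 3 / 6))%C <= K * Cmod w ^ 4.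
Proof.
  exists 100. intros w Hw. set (m := Cmod w) in *.
  assert (Hm : 0 <= m) by apply Cmod_ge_0.
  destruct w as [x y].
  pose proof (Rmax_Cmod (x, y)) as Hxy. fold m in Hxy. simpl in Hxy.
  assert (Hx : Rabs x <= m) by (eapply Rle_trans; [apply Rmax_l|exact Hxy]).
  assert (Hy : Rabs y <= m) by (eapply Rle_trans; [apply Rmax_r|exact Hxy]).
  pose proof (exp_taylor3 x ltac:(lra)) as E.
  pose proof (cos_taylor2 y ltac:(lra)) as Co.
  pose proof (sin_taylor3 y ltac:(lra)) as Si.
  assert (Hx4 : Rabs x ^ 4 <= m ^ 4) by (apply pow_incr; split; [apply Rabs_pos|auto]).
  assert (Hy4 : Rabs y ^ 4 <= m ^ 4) by (apply pow_incr; split; [apply Rabs_pos|auto]).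
  set (T := 1 + x + x ^ 2 / 2 + x ^ 3 / 6) in *.
  assert (HT : Rabs T <= 3).
  { assert (Rabs x <= 1) by lra. apply Rabs_le_between in H.
    apply Rabs_le. unfold T. nra. }
  assert (Hmono : forall i j, (4 <= i + j)%nat -> Rabs (x ^ i * y ^ j) <= m ^ 4).
  { intros i j Hij. rewrite Rabs_mult, <- !RPow_abs.
    apply Rle_trans with (m ^ i * m ^ j).
    - apply Rmult_le_compat; try (apply pow_le, Rabs_pos);
        apply pow_incr; split; auto using Rabs_pos.
    - rewrite <- pow_add. replace (i + j)%nat with (4 + (i + j - 4))%nat by lia.
      rewrite pow_add. rewrite <- (Rmult_1_r (m ^ 4)) at 2.
      apply Rmult_le_compat_l; [apply pow_le; auto|].
      rewrite <- (pow1 (i + j - 4)). apply pow_incr. lra. }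
  pose proof (Hmono 2%nat 2%nat ltac:(lia)) as M22.
  pose proof (Hmono 3%nat 2%nat ltac:(lia)) as M32.
  pose proof (Hmono 3%nat 1%nat ltac:(lia)) as M31.
  pose proof (Hmono 1%nat 3%nat ltac:(lia)) as M13.
  pose proof (Hmono 2%nat 3%nat ltac:(lia)) as M23.
  pose proof (Hmono 3%nat 3%nat ltac:(lia)) as M33.
  assert (Hs : Rabs (sin y) <= 1) by (apply Rabs_le; apply SIN_bound).
  assert (Hc : Rabs (cos y) <= 1) by (apply Rabs_le; apply COS_bound).
  assert (prod : forall a b A B, Rabs a <= A -> Rabs b <= B -> Rabs (a * b) <= A * B).
  { intros a b A B Ha Hb. rewrite Rabs_mult. apply Rmult_le_compat; auto using Rabs_pos. }
  pose proof (prod _ _ _ _ E Hc) as E1. pose proof (prod _ _ _ _ E Hs) as E2.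
  pose proof (prod _ _ _ _ HT Co) as C1. pose proof (prod _ _ _ _ HT Si) as S1.
  set (Z := (_ - _)%C).
  assert (Z1 : Rabs (fst Z) <= 50 * m ^ 4).
  (* The product [T (1 - y^2 / 2)] equals the real part of the cubic polynomial minus the two
     monomials shown. *)
  { replace (fst Z) with ((exp x - T) * cos y + T * (cos y - (1 - y ^ 2 / 2))
       - x ^ 2 * y ^ 2 / 4 - x ^ 3 * y ^ 2 / 12).
    2:{ unfold Z, Cexp, T, Re, Im. simpl. field. }
    apply Rabs_le. apply Rabs_le_between in E1, C1, M22, M32. lra. }
  assert (Z2 : Rabs (snd Z) <= 50 * m ^ 4).
  { replace (snd Z) with ((exp x - T) * sin y + T * (sin y - (y - y ^ 3 / 6))
       + x ^ 3 * y ^ 1 / 6 - x ^ 1 * y ^ 3 / 6 - x ^ 2 * y ^ 3 / 12 - x ^ 3 * y ^ 3 / 36).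
    2:{ unfold Z, Cexp, T, Re, Im. simpl. field. }
    apply Rabs_le. apply Rabs_le_between in E2, S1, M31, M13, M23, M33. lra. }
  eapply Rle_trans; [apply Cmod_2Rmax|].
  assert (Q : sqrt 2 <= 2) by (rewrite <- (sqrt_square 2) at 2 by lra; apply sqrt_le_1_alt; lra).
  pose proof (sqrt_pos 2).
  assert (Rmax (Rabs (fst Z)) (Rabs (snd Z)) <= 50 * m ^ 4) by (apply Rmax_lub; auto).
  pose proof (Rle_trans _ _ _ (Rabs_pos (fst Z)) (Rmax_l _ (Rabs (snd Z)))).
  replace (100 * m ^ 4) with (2 * (50 * m ^ 4)) by ring. apply Rmult_le_compat; auto.
Qed.

(** The order is measured as [t] tends to 0 through positive reals: this determines the coefficients
    of an expansion and avoids the origin, where [f z / z] is not given by the quotient. *)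
Definition bigO (n : nat) (g : R -> C) : Prop :=
  exists K, at_right 0 (fun t => Cmod (g t) <= K * t ^ n).

(** The range [0 < t <= 1 / 2] keeps [RtoC t] in the disk and away from 0. *)
Lemma at_right_unit (P : R -> Prop) :
  (forall t, 0 < t <= 1 / 2 -> P t) -> at_right 0 P.
Proof.
  intros H. exists (mkposreal (1 / 2) ltac:(lra)). intros t Ht Ht0. apply H.
  change (Rabs (t - 0) < 1 / 2) in Ht. apply Rabs_def2 in Ht. lra.
Qed.

Lemma bigO_ext (n : nat) (g h : R -> C) :
  (forall t, 0 < t <= 1 / 2 -> g t = h t) -> bigO n g -> bigO n h.
Proof.
  intros E [K HK]. exists K. pose proof (at_right_unit _ E) as E'.
  generalize (filter_and _ _ HK E'). apply filter_imp. intros t [A B]. now rewrite <- B.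
Qed.

Lemma bigO_nonneg_const (n : nat) (g : R -> C) :
  bigO n g -> exists K, 0 <= K /\ at_right 0 (fun t => 0 < t <= 1 / 2 /\ Cmod (g t) <= K * t ^ n).
Proof.
  intros [K HK]. exists (Rabs K). split; [apply Rabs_pos|].
  generalize (filter_and _ _ HK (at_right_unit _ (fun t (H : 0 < t <= 1 / 2) => H))).
  apply filter_imp. intros t [A B]. split; auto.
  pose proof (pow_le t n ltac:(lra)). pose proof (Rle_abs K). nra.
Qed.

Lemma bigO_plus (n : nat) (g h : R -> C) :
  bigO n g -> bigO n h -> bigO n (fun t => g t + h t)%C.
Proof.
  intros [K HK] [L HL]. exists (K + L). generalize (filter_and _ _ HK HL).
  apply filter_imp. intros t [A B]. eapply Rle_trans; [apply Cmod_triangle|]. lra.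
Qed.

Lemma bigO_mult (n m : nat) (g h : R -> C) :
  bigO n g -> bigO m h -> bigO (n + m) (fun t => g t * h t)%C.
Proof.
  intros Hg Hh. destruct (bigO_nonneg_const _ _ Hg) as [K [K0 HK]].
  destruct (bigO_nonneg_const _ _ Hh) as [L [L0 HL]].
  exists (K * L). generalize (filter_and _ _ HK HL).
  apply filter_imp. intros t [[A B] [_ D]]. rewrite Cmod_mult, pow_add.
  replace (K * L * (t ^ n * t ^ m)) with ((K * t ^ n) * (L * t ^ m)) by ring.
  apply Rmult_le_compat; auto using Cmod_ge_0.
Qed.

Lemma bigO_weaken (n m : nat) (g : R -> C) : (n <= m)%nat -> bigO m g -> bigO n g.
Proof.
  intros Hnm Hg. destruct (bigO_nonneg_const _ _ Hg) as [K [K0 HK]]. exists K.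
  revert HK. apply filter_imp. intros t [A B]. eapply Rle_trans; [exact B|].
  apply Rmult_le_compat_l; auto.
  replace m with (n + (m - n))%nat by lia. rewrite pow_add.
  rewrite <- (Rmult_1_r (t ^ n)) at 2. apply Rmult_le_compat_l; [apply pow_le; lra|].
  rewrite <- (pow1 (m - n)). apply pow_incr. lra.
Qed.

Lemma bigO_const (c : C) : bigO 0 (fun _ => c).
Proof. exists (Cmod c). apply at_right_unit. intros t _. simpl. lra. Qed.

Lemma bigO_pow (n : nat) : bigO n (fun t => RtoC t ^ n)%C.
Proof.
  exists 1. apply at_right_unit. intros t Ht.
  rewrite Cmod_pow, Cmod_R, Rabs_pos_eq; lra.
Qed.

Lemma bigO_monomial (c : C) (n : nat) : bigO n (fun t => c * RtoC t ^ n)%C.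
Proof. exact (bigO_mult 0 n _ _ (bigO_const c) (bigO_pow n)). Qed.

Lemma bigO_div (n : nat) (g : R -> C) :
  bigO (S n) (fun t => RtoC t * g t)%C -> bigO n g.
Proof.
  intros H. destruct (bigO_nonneg_const _ _ H) as [K [K0 HK]]. exists K.
  revert HK. apply filter_imp. intros t [A B].
  rewrite Cmod_mult, Cmod_R, Rabs_pos_eq in B by lra. simpl in B.
  apply Rmult_le_reg_l with t; [lra|]. lra.
Qed.

Lemma bigO_const_eq0 (c : C) : bigO 1 (fun _ => c) -> c = RtoC 0.
Proof.
  intros H. destruct (bigO_nonneg_const _ _ H) as [K [K0 [d Hd]]].
  apply Cmod_eq_0. apply Rle_antisym; [|apply Cmod_ge_0].
  apply le_epsilon. intros e He. rewrite Rplus_0_l.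
  set (t := Rmin (d / 2) (e / (K + 1))).
  pose proof (cond_pos d).
  assert (Ht : 0 < t) by (apply Rmin_glb_lt; [lra|apply Rdiv_lt_0_compat; lra]).
  assert (Ht1 : t <= d / 2) by apply Rmin_l.
  destruct (Hd t) as [_ B]; auto.
  { change (Rabs (t - 0) < d). rewrite Rminus_0_r, Rabs_pos_eq; lra. }
  assert (t * (K + 1) <= e).
  { apply Rle_trans with (e / (K + 1) * (K + 1)).
    - apply Rmult_le_compat_r; [lra|apply Rmin_r].
    - right. field. lra. }
  simpl in B. nra.
Qed.

(** Since [t g(t)] is [O(t)], so is the constant [c], which must vanish; dividing by [t] then lowers
    the order by one. Applied to a polynomial in Horner form, this peels off its coefficients one by
    one. *)
Lemma bigO_head_eq0 (n : nat) (c : C) (g : R -> C) :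
  bigO 0 g -> bigO (S n) (fun t => c + RtoC t * g t)%C -> c = RtoC 0 /\ bigO n g.
Proof.
  intros Hg H.
  assert (E : c = RtoC 0).
  { apply bigO_const_eq0.
    pose proof (bigO_mult 0 1 _ _ (bigO_mult 0 0 _ _ (bigO_const (RtoC (-1))) Hg) (bigO_pow 1)) as A.
    pose proof (bigO_plus 1 _ _ (bigO_weaken 1 (S n) _ ltac:(lia) H) A) as B.
    revert B. apply bigO_ext. intros t _. simpl. ring. }
  split; auto. apply bigO_div. revert H. apply bigO_ext. intros t _. rewrite E. ring.
Qed.

Lemma bigO_cubic_eq0 (q0 q1 q2 q3 : C) :
  bigO 4 (fun t => q0 + q1 * RtoC t ^ 1 + q2 * RtoC t ^ 2 + q3 * RtoC t ^ 3)%C ->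
  q0 = RtoC 0 /\ q1 = RtoC 0 /\ q2 = RtoC 0 /\ q3 = RtoC 0.
Proof.
  intros H.
  assert (G : forall c g, bigO 0 g -> bigO 0 (fun t => c + RtoC t * g t)%C).
  { intros c g Hg. apply bigO_plus; [apply bigO_const|].
    apply (bigO_mult 0 0); auto. apply (bigO_weaken 0 1); [lia|].
    generalize (bigO_pow 1). apply bigO_ext. intros t _. apply Cpow_1_r. }
  set (g3 := fun _ : R => q3). set (g2 := fun t => (q2 + RtoC t * g3 t)%C).
  set (g1 := fun t => (q1 + RtoC t * g2 t)%C).
  assert (B3 : bigO 0 g3) by apply bigO_const.
  assert (B2 : bigO 0 g2) by now apply G.
  assert (B1 : bigO 0 g1) by now apply G.
  destruct (bigO_head_eq0 3 q0 g1 B1) as [E0 H1].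
  { revert H. apply bigO_ext. intros t _. unfold g1, g2, g3. simpl. ring. }
  destruct (bigO_head_eq0 2 q1 g2 B2 H1) as [E1 H2].
  destruct (bigO_head_eq0 1 q2 g3 B3 H2) as [E2 H3].
  repeat split; auto. now apply bigO_const_eq0.
Qed.

Lemma pseries1_jet (b : nat -> C) (g : C -> C) :
  (forall z, in_disk z -> z <> RtoC 0 -> is_pseries1 b z (g z)) ->
  bigO 5 (fun t => g (RtoC t) - (b 1%nat * RtoC t ^ 1 + b 2%nat * RtoC t ^ 2
                     + b 3%nat * RtoC t ^ 3 + b 4%nat * RtoC t ^ 4))%C.
Proof.
  intros H.
  assert (Hb : ex_series (fun n => Cmod (b (S n)) * (1 / 2) ^ n)).
  { apply (ex_series_Cmod_disk (fun n => b (S n))); [|lra].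
    intros z Hz. destruct (Ceq_dec z 0) as [->|Hz0].
    (* The hypothesis excludes the origin; there every term after the first vanishes, and the tail
       is obtained as 0 times the convergent series at 1/2. *)
    - assert (H2 : is_pseries1 b (RtoC (1 / 2)) (g (RtoC (1 / 2)))).
      { apply H; [unfold in_disk; rewrite Cmod_R, Rabs_pos_eq; lra|].
        intros A. apply RtoC_inj in A. lra. }
      exists (b 1%nat * 0 ^ 0 + 0 * g (RtoC (1 / 2)))%C.
      apply (is_seriesC_cons (fun n => b (S n) * 0 ^ n)%C).
      eapply is_seriesC_ext; [|exact (is_seriesC_mult 0 _ _ H2)].
      intros n. cbv beta. simpl. ring.
    - exists (/ z * g z)%C.
      eapply is_seriesC_ext; [|exact (is_seriesC_mult (/ z)%C _ _ (H z Hz Hz0))].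
      intros n. cbv beta. simpl. field. auto. }
  apply (ex_series_incr_n _ 4) in Hb.
  set (v := fun k => Cmod (b (S (4 + k))) * (1 / 2) ^ (4 + k)) in Hb.
  (* For [t <= 1/2] one has [t^(5+k) <= t^5 (1/2)^k]; the factor [16 = 2^4] turns [(1/2)^k] into the
     [(1/2)^(4+k)] of [v]. *)
  exists (16 * Series v). apply at_right_unit. intros t Ht.
  assert (Hd : in_disk (RtoC t)) by (unfold in_disk; rewrite Cmod_R, Rabs_pos_eq; lra).
  assert (H0 : RtoC t <> RtoC 0) by (intros A; apply RtoC_inj in A; lra).
  pose proof (is_seriesC_remainder _ _ 3 (H _ Hd H0)) as R.
  rewrite !csum_S, sum_O in R.
  rewrite (Rmult_comm 16), Rmult_assoc, <- Series_scal_r.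
  apply (is_seriesC_mod_le _ _ _ R).
  - intros k. unfold v. rewrite Cmod_mult, Cmod_pow, Cmod_R, Rabs_pos_eq by lra.
    rewrite Rmult_assoc. apply Rmult_le_compat_l; [apply Cmod_ge_0|].
    replace (S (4 + k)) with (5 + k)%nat by lia. rewrite !pow_add.
    assert (t ^ k <= (1 / 2) ^ k) by (apply pow_incr; lra).
    assert (0 <= t ^ 5) by (apply pow_le; lra).
    replace ((1 / 2) ^ 4 * (1 / 2) ^ k * (16 * t ^ 5)) with (t ^ 5 * (1 / 2) ^ k) by field.
    now apply Rmult_le_compat_l.
  - now apply ex_series_scal_r.
Qed.

Lemma bigO_comp (n : nat) (g : C -> C) (W : R -> C) (K : R) :
  (forall w, Cmod w <= 1 -> Cmod (g w) <= K * Cmod w ^ n) ->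
  bigO 1 W -> bigO n (fun t => g (W t)).
Proof.
  intros Hg HW. destruct (bigO_nonneg_const _ _ HW) as [L [L0 HL]].
  exists (Rabs K * L ^ n).
  assert (S : at_right 0 (fun t => L * t <= 1)).
  { assert (Hd : 0 < / (L + 1)) by (apply Rinv_0_lt_compat; lra).
    exists (mkposreal _ Hd). intros t Ht Ht0.
    change (Rabs (t - 0) < / (L + 1)) in Ht. apply Rabs_def2 in Ht.
    assert (t * (L + 1) <= / (L + 1) * (L + 1)) by (apply Rmult_le_compat_r; lra).
    rewrite Rinv_l in H by lra. lra. }
  generalize (filter_and _ _ HL S). apply filter_imp. intros t [[A B] D].
  rewrite pow_1 in B. eapply Rle_trans; [apply Hg; lra|].
  rewrite Rmult_assoc, <- Rpow_mult_distr.
  assert (Cmod (W t) ^ n <= (L * t) ^ n) by (apply pow_incr; split; [apply Cmod_ge_0|auto]).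
  pose proof (pow_le _ n (Cmod_ge_0 (W t))). pose proof (Rle_abs K). pose proof (Rabs_pos K). nra.
Qed.

(** Let [P] be the cubic Taylor polynomial of the exponential and [V] the given cubic in [t]. The
    error splits into [exp W - P(W)], [P(W) - P(V)] and the part of [P(V)] of degree at least 4,
    each of order [t^4]. *)
Lemma Cexp_jet (W : R -> C) (l1 l2 l3 : C) :
  bigO 4 (fun t => W t - (l1 * RtoC t ^ 1 + l2 * RtoC t ^ 2 + l3 * RtoC t ^ 3))%C ->
  bigO 4 (fun t => Cexp (W t) - (1 + l1 * RtoC t ^ 1 + (l2 + l1 ^ 2 / 2) * RtoC t ^ 2
                     + (l3 + l1 * l2 + l1 ^ 3 / 6) * RtoC t ^ 3))%C.
Proof.
  intros H. set (V := fun t => (l1 * RtoC t ^ 1 + l2 * RtoC t ^ 2 + l3 * RtoC t ^ 3)%C).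
  assert (HV : bigO 1 V).
  { unfold V. repeat apply bigO_plus.
    - apply bigO_monomial.
    - apply (bigO_weaken 1 2); [lia|apply bigO_monomial].
    - apply (bigO_weaken 1 3); [lia|apply bigO_monomial]. }
  assert (HW : bigO 1 W).
  { pose proof (bigO_plus 1 _ _ (bigO_weaken 1 4 _ ltac:(lia) H) HV) as A.
    revert A. apply bigO_ext. intros t _. unfold V. ring. }
  destruct Cexp_taylor3 as [K HK].
  pose proof (bigO_comp 4 _ W K HK HW) as T.
  (* The function here is the cofactor in [P(W) - P(V) = (W - V) Q], for
     [P(w) = 1 + w + w^2/2 + w^3/6]. *)
  assert (HQ : bigO 0 (fun t => 1 + (W t + V t) * (1 / 2) + (W t * W t + W t * V t + V t * V t) * (1 / 6))%C).
  { assert (P2 : forall f g, bigO 1 f -> bigO 1 g -> bigO 0 (fun t => f t * g t)%C).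
    { intros f g Hf Hg. apply (bigO_weaken 0 2); [lia|]. now apply (bigO_mult 1 1). }
    assert (P0 : forall c f, bigO 0 f -> bigO 0 (fun t => f t * c)%C).
    { intros c f Hf. apply (bigO_mult 0 0 f (fun _ => c)); [auto|apply bigO_const]. }
    assert (W0 : bigO 0 W) by (apply (bigO_weaken 0 1); auto).
    assert (V0 : bigO 0 V) by (apply (bigO_weaken 0 1); auto).
    apply bigO_plus; [apply bigO_plus; [apply bigO_const|]|]; apply P0.
    - now apply bigO_plus.
    - apply bigO_plus; [apply bigO_plus|]; now apply P2. }
  pose proof (bigO_mult 4 0 _ _ H HQ) as D.
  (* These are the terms of degrees 4 to 9 of [P(V)]. *)
  assert (Hrest : bigO 4 (fun t => (l2 ^ 2 / 2 + l1 * l3 + l1 ^ 2 * l2 / 2) * RtoC t ^ 4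
      + (l2 * l3 + l1 ^ 2 * l3 / 2 + l1 * l2 ^ 2 / 2) * RtoC t ^ 5
      + (l3 ^ 2 / 2 + l1 * l2 * l3 + l2 ^ 3 / 6) * RtoC t ^ 6
      + (l1 * l3 ^ 2 / 2 + l2 ^ 2 * l3 / 2) * RtoC t ^ 7
      + (l2 * l3 ^ 2 / 2) * RtoC t ^ 8 + (l3 ^ 3 / 6) * RtoC t ^ 9)%C).
  { repeat apply bigO_plus;
      match goal with |- bigO 4 (fun t => _ * RtoC t ^ ?n)%C =>
        apply (bigO_weaken 4 n); [lia|apply bigO_monomial] end. }
  pose proof (bigO_plus 4 _ _ (bigO_plus 4 _ _ T D) Hrest) as E.
  revert E. apply bigO_ext. intros t _. cbv beta. unfold V.
  field.
Qed.

(** * Logarithmic coefficients and the final bound *)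

Lemma log_coeffs_relations (f : C -> C) (a gamma : nat -> C) :
  a 1%nat = RtoC 1 -> (forall z, in_disk z -> is_pseries1 a z (f z)) ->
  is_log_coeffs f gamma ->
  (a 2%nat = 2 * gamma 1%nat)%C /\
  (a 3%nat = 2 * gamma 2%nat + (2 * gamma 1%nat) ^ 2 / 2)%C /\
  (a 4%nat = 2 * gamma 3%nat + (2 * gamma 1%nat) * (2 * gamma 2%nat) + (2 * gamma 1%nat) ^ 3 / 6)%C.
Proof.
  intros H1 Hf [L [[_ [_ HL]] Hg]].
  pose proof (pseries1_jet _ f (fun z Hz _ => Hf z Hz)) as Jf.
  pose proof (pseries1_jet _ L Hg) as JL. cbv beta in JL.
  set (l1 := (2 * gamma 1%nat)%C) in *. set (l2 := (2 * gamma 2%nat)%C) in *.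
  set (l3 := (2 * gamma 3%nat)%C) in *.
  (* The expansion of [f] is needed through [t^4], as one order is lost on dividing by [t]; for [L]
     the [t^4] term is absorbed into the error. *)
  assert (JL4 : bigO 4 (fun t => L (RtoC t) - (l1 * RtoC t ^ 1 + l2 * RtoC t ^ 2 + l3 * RtoC t ^ 3))%C).
  { pose proof (bigO_plus 4 _ _ (bigO_weaken 4 5 _ ltac:(lia) JL) (bigO_monomial (2 * gamma 4%nat)%C 4)) as A.
    revert A. apply bigO_ext. intros t _. ring. }
  apply Cexp_jet in JL4.
  assert (Jq : bigO 4 (fun t => f (RtoC t) / RtoC t - (1 + a 2%nat * RtoC t ^ 1 + a 3%nat * RtoC t ^ 2 + a 4%nat * RtoC t ^ 3))%C).
  { apply bigO_div. revert Jf. apply bigO_ext. intros t Ht. rewrite H1. field.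
    intros A. apply RtoC_inj in A. lra. }
  assert (Z : bigO 4 (fun t => RtoC 0 + (a 2%nat - l1) * RtoC t ^ 1 + (a 3%nat - (l2 + l1 ^ 2 / 2)) * RtoC t ^ 2
      + (a 4%nat - (l3 + l1 * l2 + l1 ^ 3 / 6)) * RtoC t ^ 3)%C).
  { pose proof (bigO_plus 4 _ _ JL4 (bigO_mult 0 4 _ _ (bigO_const (RtoC (-1))) Jq)) as A.
    revert A. apply bigO_ext. intros t Ht. cbv beta. rewrite HL.
    - field. intros A. apply RtoC_inj in A. lra.
    - unfold in_disk. rewrite Cmod_R, Rabs_pos_eq; lra.
    - intros A. apply RtoC_inj in A. lra. }
  apply bigO_cubic_eq0 in Z. destruct Z as [_ [Z1 [Z2 Z3]]].
  assert (S : forall u v : C, (u - v)%C = RtoC 0 -> u = v).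
  { intros u v E. replace u with (u - v + v)%C by ring. rewrite E. ring. }
  auto.
Qed.

Theorem theorem2p2 (f : C -> C) (hf : class_F2 f)
    (gamma : nat -> C) (hgamma : is_log_coeffs f gamma) :
  Cmod (gamma 3%nat) <= gamma3_bound.
Proof.
  destruct hf as [[[a [H1 Hf]] _] Hp].
  pose proof (caratheodory_functional _ (class_F2_coeffs f a H1 Hf Hp)) as B.
  destruct (log_coeffs_relations f a gamma H1 Hf hgamma) as [E2 [E3 E4]].
  replace (2 * p_coeff a 1 + 6 * p_coeff a 3 - 4 * p_coeff a 1 * p_coeff a 2 + p_coeff a 1 ^ 3)%C
    with (48 * gamma 3%nat)%C in B.
  - rewrite Cmod_mult, Cmod_R, Rabs_pos_eq in B by lra. lra.
  - unfold p_coeff. rewrite H1, E2, E3, E4. rewrite !S_INR, !RtoC_plus. simpl INR. field.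
Qed.
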